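(* Let $g\geq1$, $n=2g+1$, and let $m$ be a positive squarefree integer. There exists a map $\sigma_m:\mathcal{W}_m^{(2)}\to\frac12W_0(\mathbb{Z})$ such that for every $f\in\mathcal{W}_m^{(2)}$: $f_{\sigma_m(f)}=f$; for every odd prime $p\mid m$, $p^2$ strongly divides $\Delta(\sigma_m(f))$ as an element of $\frac12W_0(\mathbb{Z})$; and $|Q(\sigma_m(f))|=m$.
   Context: $W$ is the space of symmetric $n\times n$ matrices, $W_0\subset W$ the subspace of matrices whose top-left $g\times g$ block is zero, and $\frac12W_0(\mathbb{Z})$ the set of elements of $W_0$ with entries in $\frac12\mathbb{Z}$. $A_0$ is the $n\times n$ matrix with $1$'s on the anti-diagonal and $0$'s elsewhere; for $B\in W$, $f_B(x)=(-1)^g\det(A_0x-B)$ and $\Delta(B)=\Delta(f_B)$ (discriminant). For an odd prime $p$ and $B\in\frac12W_0(\mathbb{Z})$, ''$p^2$ strongly divides $\Delta(B)$ as an element of $\frac12W_0(\mathbb{Z})$'' means $v_p(\Delta(B+pC))\geq 2$ for every $C\in\frac12W_0(\mathbb{Z})$. $Q$ on $W_0$: for $B\in W_0$ let $B^{\mathrm{top}}$, $A_0^{\mathrm{top}}$ be the top-right $g\times(g+1)$ blocks; for $g\times(g+1)$ matrices $(A,B')$, let $M(x,y)$ be the vector whose $i$-th entry is $(-1)^{i-1}$ times the determinant of $Ax-B'y$ with its $i$-th column deleted (a binary form of degree $g$), and let $Q(A,B')$ be the determinant of the $(g+1)\times(g+1)$ matrix of coefficients of these $g+1$ forms; $Q(B)=Q(A_0^{\mathrm{top}},B^{\mathrm{top}})$.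 Monic integer polynomials $f$ of degree $n$: $p^2$ weakly divides $\Delta(f)$ if $p^2\mid\Delta(f)$ and $f\bmod p$ has exactly one multiple root, which lies in $\mathbb{F}_p$ and is a double root; $\mathcal{W}_m^{(2)}$ is the set of monic integer polynomials of degree $n$ whose discriminant is weakly divisible by $p^2$ for every prime $p\mid m$. *)

(* Defs.v *)
From HB Require Import structures.
From mathcomp Require Import all_boot all_order all_algebra all_field.

Set Implicit Arguments.
Unset Strict Implicit.
Unset Printing Implicit Defensive.

Import Order.TTheory GRing.Theory Num.Theory.
Local Open Scope ring_scope.

(* The dimension n = 2g+1 is written g + g.+1, so that the top-left g x g block
   and the top-right g x (g+1) block are [ulsubmx] and [ursubmx]. *)

(* For monic p only (no division by the leading coefficient), and with deg p
   nonzero in R, so that p^`() has degree exactly deg p - 1. *)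
Definition discr (R : comNzRingType) (p : {poly R}) : R :=
  (-1) ^+ 'C((size p).-1, 2) * resultant p p^`().

Definition squarefree (m : nat) : Prop :=
  forall d : nat, (d ^ 2 %| m)%N -> d = 1%N.

(* k <= v_p(x), with v_p(0) = +oo. *)
Definition padic_val_ge (p : nat) (k : int) (x : rat) : Prop :=
  x = 0 \/ k <= (logn p `|numq x|)%:Z - (logn p `|denq x|)%:Z.

Definition Fpbar (p : nat) : countClosedFieldType :=
  projT1 (countable_algebraic_closure 'F_p).

Definition Fp_to_Fpbar (p : nat) : {rmorphism 'F_p -> Fpbar p} :=
  proj1_sig (projT2 (countable_algebraic_closure 'F_p)).

(* Multiplicity of x, in the algebraic closure of F_p, as a root of f mod p. *)
Definition mult_mod (p : nat) (f : {poly int}) (x : Fpbar p) : nat :=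
  mup x (map_poly (Fp_to_Fpbar p) (map_poly (intr : int -> 'F_p) f)).

Definition weakly_divides (p : nat) (f : {poly int}) : Prop :=
  ((p ^ 2)%:Z %| discr f)%Z /\
  exists r : 'F_p,
    mult_mod f (Fp_to_Fpbar p r) = 2%N /\
    forall x : Fpbar p, (2 <= mult_mod f x)%N -> x = Fp_to_Fpbar p r.

Definition in_Wm2 (g m : nat) (f : {poly int}) : Prop :=
  [/\ f \is monic, size f = (2 * g + 1).+1 &
      forall p : nat, prime p -> (p %| m)%N -> weakly_divides p f].

Definition A0 (g : nat) : 'M[rat]_(g + g.+1) :=
  \matrix_(i, j) (j == rev_ord i)%:R.

Definition fB (g : nat) (B : 'M[rat]_(g + g.+1)) : {poly rat} :=
  (-1) ^+ g * \det ('X *: map_mx polyC (A0 g) - map_mx polyC B).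

Definition DeltaB (g : nat) (B : 'M[rat]_(g + g.+1)) : rat := discr (fB B).

Definition in_W0 (g : nat) (B : 'M[rat]_(g + g.+1)) : Prop :=
  B^T = B /\ ulsubmx B = 0.

Definition in_half_W0Z (g : nat) (B : 'M[rat]_(g + g.+1)) : Prop :=
  in_W0 B /\ forall i j, 2%:R * B i j \is a Num.int.

Definition strongly_divides (g p : nat) (B : 'M[rat]_(g + g.+1)) : Prop :=
  forall C : 'M[rat]_(g + g.+1),
    in_half_W0Z C -> padic_val_ge p 2 (DeltaB (B + p%:R *: C)).

(* The binary forms live in {poly {poly R}} with x := 'X and y := 'X%:P, so the
   coefficient of x^a y^b in P is P`_a`_b.  As indices start at 0, the sign
   (-1)^(i-1) becomes (-1)^i. *)
Definition minor_form (R : comNzRingType) (g : nat) (A B : 'M[R]_(g, g.+1))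
    (i : 'I_g.+1) : {poly {poly R}} :=
  (-1) ^+ i * \det (col' i ('X *: map_mx (fun c : R => c%:P%:P) A
                            - 'X%:P *: map_mx (fun c : R => c%:P%:P) B)).

(* Column k holds the coefficients of x^(g-k) y^k. *)
Definition Qpair (R : comNzRingType) (g : nat) (A B : 'M[R]_(g, g.+1)) : R :=
  \det (\matrix_(i < g.+1, k < g.+1) (minor_form A B i)`_(g - k)`_k).

Definition Q (g : nat) (B : 'M[rat]_(g + g.+1)) : rat :=
  Qpair (ursubmx (A0 g)) (ursubmx B).

(* Main.v *)
Require Import Defs.
From HB Require Import structures.
From mathcomp Require Import all_boot all_order all_fingroup all_algebra all_field.
From mathcomp Require Import zify ring.

(* Expand f = sum_k a_k (X - l)^k around an integer l that reduces to the double
   root of f modulo every prime p | m.  Then m | a_1 and, for odd p, the condition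
   p^2 | disc f forces p^2 | a_0: dividing by p the evaluation-at-l column of the
   Sylvester matrix of (f, f') gives a matrix that is nonsingular mod p unless
   p | a_0 / p.  For p = 2 only 2 | a_0 holds, but half-integral diagonal entries
   suffice there.

   Let B be l A_0 plus the symmetric matrix with zero top-left block, with
   m, 1, ..., 1 just above the antidiagonal in the top-right block N, and with a
   tridiagonal (up to reversal) bottom-right block.  The vector
   v = (y^g, ..., y, m), y = X - l, spans the kernel of the top-right block of
   X A_0 - B, so f_B is the value of the bottom-right block at v; the a_k enter
   through the products v_i v_j with |i - j| <= 1, after division by m^2 (k = 0)
   or m (k = 1).  The same kernel relation computes the forms defining Q, whose
   coefficient matrix is triangular with diagonal +-1, ..., +-1, +-m.

   Strong divisibility: the first row and column of X A_0 - (B + pC) are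
   p r + y e with a zero corner, so f_{B+pC} = p^2 D_1 + p y D_2 + y^2 D_3, and the
   modified Sylvester matrix is singular mod p. *)

Set Implicit Arguments.
Unset Strict Implicit.
Unset Printing Implicit Defensive.

Import Order.TTheory GRing.Theory Num.Theory.
Local Open Scope ring_scope.

(** * Determinants of bordered matrices *)

(** Reversing the columns makes [A] triangular. The sign is left as that of a permutation, since
    later it is only squared or taken in absolute value. *)
Lemma det_antitrig (R : comNzRingType) n (A : 'M[R]_n) :
    (forall i j : 'I_n, (n <= i + j)%N -> A i j = 0) ->
  \det A = (-1) ^+ perm (@rev_ord_inj n) * \prod_i A i (rev_ord i).
Proof.
move=> A0; set s := perm _.
have : \det (col_perm s A)^T = \prod_i A i (rev_ord i).
  rewrite det_trig; first by apply: eq_bigr => i _; rewrite !mxE permE.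
  by apply/is_trig_mxP => i j ltij; rewrite !mxE A0 // permE /=; have := ltn_ord j; lia.
rewrite det_tr col_permE det_mulmx det_perm odd_permV mulrC => <-.
by rewrite signrMK.
Qed.

Section Blocks.
Variables (R : comNzRingType) (g : nat).

Let antidiag_blocks (K K' : 'M[R]_g) (q : 'M_1) r r' S : 'M_(g + (1 + g)) :=
  block_mx 0 (row_mx 0 K) (col_mx 0 K') (block_mx q r r' S).

(** Unimodular block operations turn the exchange matrix into an upper triangular one with diagonal
    blocks I, 1 and -I. *)
Let det_exchange : \det (antidiag_blocks 1%:M 1%:M 1%:M 0 0 0) = (-1) ^+ g.
Proof.
rewrite /antidiag_blocks; set Z := block_mx _ _ _ _.
pose L1 : 'M[R]_(g + (1 + g)) := block_mx 1%:M 0 (col_mx 0 1%:M) 1%:M.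
pose L2 : 'M[R]_(g + (1 + g)) := block_mx 1%:M 0 (- col_mx 0 1%:M) 1%:M.
have: \det (L2 *m (Z *m L1)) = (-1) ^+ g.
  rewrite /L1 /Z /L2 !mulmx_block !mul0mx !mulmx0 !mul1mx !mulmx1 !add0r !addr0.
  rewrite mul_row_col mul0mx mul1mx add0r mulNmx mulmx1 addrC mul_block_col.
  rewrite !mulmx0 !mul0mx !addr0 col_mx0 addr0 subrr det_ublock det1 mul1r.
  rewrite mulNmx mul_col_row !mul0mx !mul1mx opp_block_mx add_block_mx.
  by rewrite !oppr0 !add0r !addr0 det_ublock det1 mul1r -scaleN1r detZ det1 mulr1.
by rewrite !det_mulmx !det_lblock !det1 !mulr1 !mul1r.
Qed.

(** Right multiplication by the exchange matrix gives a block lower triangular matrix with diagonal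
    blocks [K], [q], [K']. *)
Lemma det_antidiag_blocks (K K' : 'M[R]_g) (q : 'M_1) r r' S :
  \det (block_mx 0 (row_mx 0 K) (col_mx 0 K') (block_mx q r r' S)) =
  (-1) ^+ g * \det K * \det K' * q 0 0.
Proof.
rewrite -/(antidiag_blocks K K' q r r' S).
apply: (can_inj (signrMK g)); rewrite -!mulrA signrMK -det_exchange.
rewrite [LHS]mulrC -det_mulmx !mulmx_block !mul0mx !mulmx0 !add0r !mulmx1 !addr0.
rewrite mul_row_block mul_block_col !mul_row_col mul_col_row !mulmx0 !mulmx1.
rewrite ?mul0mx !addr0 !add0r add_block_mx !add0r !addr0 row_mx0 !det_lblock det_mx11.
by ring.
Qed.

(* Completing the kernel vector v of N to a basis, a congruence turns N into
   [0 | N1], and the quadratic form S enters only through its value at v. *)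
Lemma det_kernel_border (N0 : 'cV[R]_g) (N1 : 'M[R]_g) (S : 'M[R]_(1 + g))
    (v0 : R) (v1 : 'cV_g) (N := row_mx N0 N1) (v := col_mx v0%:M v1) :
    N *m v = 0 ->
  v0 ^+ 2 * \det (block_mx 0 N N^T S) =
  (-1) ^+ g * \det N1 ^+ 2 * (v^T *m S *m v) 0 0.
Proof.
move=> Nv0; pose V : 'M[R]_(1 + g) := row_mx v (col_mx 0 1%:M).
pose T : 'M[R]_(g + (1 + g)) := block_mx 1%:M 0 0 V.
have dT : \det T = v0.
  rewrite /T det_ublock det1 mul1r /V /v.
  have -> : row_mx (col_mx v0%:M v1) (col_mx 0 1%:M) =
            block_mx v0%:M 0 v1 (1%:M : 'M_g) by rewrite block_mxEh.
  by rewrite det_lblock det1 mulr1 det_mx11 mxE.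
have dT' : \det T^T = v0 by rewrite det_tr.
have NV : N *m V = row_mx 0 N1.
  by rewrite /V mul_mx_row Nv0 /N mul_row_col mulmx0 mulmx1 add0r.
have := det_antidiag_blocks N1 N1^T (v^T *m S *m v) (v^T *m S *m col_mx 0 1%:M)
         ((col_mx 0 1%:M)^T *m S *m v)
         ((col_mx 0 1%:M)^T *m S *m col_mx 0 1%:M).
rewrite det_tr -[_ * \det N1 * \det N1]mulrA -expr2 => <-.
have -> : block_mx (v^T *m S *m v) (v^T *m S *m col_mx 0 1%:M)
            ((col_mx 0 1%:M)^T *m S *m v)
         ((col_mx 0 1%:M)^T *m S *m col_mx 0 1%:M)
          = V^T *m S *m V :> 'M_(1 + g).
  by rewrite /V tr_row_mx mul_col_mx mul_col_row.
have -> : block_mx 0 (row_mx 0 N1) (col_mx 0 N1^T) (V^T *m S *m V) =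
          T^T *m block_mx 0 N N^T S *m T.
  rewrite /T tr_block_mx !mulmx_block !trmx0 !trmx1 !mul0mx !mulmx0 !mul1mx.
  rewrite !add0r !addr0 mul0mx mulmx1.
  by rewrite -trmx_mul NV [(row_mx 0 N1)^T]tr_row_mx trmx0.
by rewrite !det_mulmx dT dT'; ring.
Qed.

End Blocks.

(** Because the corner is zero, the determinant is linear in the bordering row and in the bordering
    column separately. *)
Lemma det_border_bilinear (R : comNzRingType) k (r1 r2 : 'rV[R]_k)
    (c1 c2 : 'cV[R]_k) (M : 'M_k) (a b : R) :
  let D r c := \det (block_mx (0 : 'M_1) r c M) in
  D (a *: r1 + b *: r2) (a *: c1 + b *: c2) =
  a ^+ 2 * D r1 c1 + a * b * (D r1 c2 + D r2 c1) + b ^+ 2 * D r2 c2.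
Proof.
move=> D.
have row_lin r r' c : D (a *: r + b *: r') c = a * D r c + b * D r' c.
  apply: (determinant_multilinear (i0 := lshift k 0)).
  - rewrite !rowKu; apply/rowP=> j; rewrite !mxE.
    by case: split => i; rewrite !mxE // !mulr0 addr0.
  - by apply/matrixP=> i j; rewrite !mxE; case: splitP => // i' /=; rewrite ord1.
  - by apply/matrixP=> i j; rewrite !mxE; case: splitP => // i' /=; rewrite ord1.
have col_lin r c c' : D r (a *: c + b *: c') = a * D r c + b * D r c'.
  have trD c'' : D r c'' = \det (block_mx (0 : 'M_1) c''^T r^T M^T).
    by rewrite -[LHS]det_tr tr_block_mx trmx0.
  rewrite !trD linearD !linearZ /=.
  apply: (determinant_multilinear (i0 := lshift k 0)).
  - rewrite !rowKu; apply/rowP=> j; rewrite !mxE.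
    by case: split => i; rewrite !mxE // !mulr0 addr0.
  - by apply/matrixP=> i j; rewrite !mxE; case: splitP => // i' /=; rewrite ord1.
  - by apply/matrixP=> i j; rewrite !mxE; case: splitP => // i' /=; rewrite ord1.
by rewrite row_lin !col_lin; ring.
Qed.

(** The sum is the expansion along the top row of [W] with its row [r] repeated on top, a singular
    matrix. *)
Lemma signed_minors_kernel (R : comNzRingType) g (W : 'M[R]_(g, g.+1)) (r : 'I_g) :
  \sum_j W r j * ((-1) ^+ j * \det (col' j W)) = 0.
Proof.
pose A : 'M[R]_(1 + g) := col_mx (row r W) W.
have: \det A = 0.
  apply: (determinant_alternate (i1 := lshift g 0) (i2 := rshift 1 r)) => [|j].
    by rewrite eq_lrshift.
  by rewrite col_mxEu col_mxEd mxE.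
rewrite (expand_det_row _ (lshift g 0)) => {2}<-; apply: eq_bigr => j _.
rewrite col_mxEu mxE /cofactor add0n; congr (_ * (_ * \det _)).
apply/matrixP => i k; rewrite !mxE.
case: splitP => [i'|i' /= Ei]; first by rewrite ord1.
by congr (W _ _); apply/val_inj; case: Ei.
Qed.

(** * Resultants modulo the square of a prime *)

Lemma dvdz_Fp (p : nat) (n : int) :
  prime p -> (p%:Z %| n)%Z = ((n%:~R : 'F_p) == 0).
Proof. by move=> pP; rewrite -(dvdz_pcharf (pchar_Fp pP)). Qed.

Lemma rVpoly_sum (R : nzRingType) d (u : 'rV[R]_d) :
  rVpoly u = \sum_k u 0 k *: 'X^k.
Proof.
rewrite {1}[u]row_sum_delta linear_sum; apply: eq_bigr => k _.
by rewrite linearZ /= rVpoly_delta.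
Qed.

Section ResultantModSquare.
Variables (p : nat) (f q : {poly int}) (a alpha beta : int).
Hypotheses (pP : prime p) (f_gt1 : (1 < size f)%N).
Hypotheses (fa : f.[a] = p%:Z * alpha) (qa : q.[a] = p%:Z * beta).

Let dq := (size q).-1.
Let df := (size f).-1.
Let phi : {rmorphism int -> 'F_p} := intr.

Let rowpoly (i : 'I_(dq + df)) : {poly int} :=
  match split i with inl k => 'X^k * f | inr k => 'X^k * q end.

Let rowval (i : 'I_(dq + df)) : int :=
  match split i with inl k => a ^+ k * alpha | inr k => a ^+ k * beta end.

Let d_gt0 : (0 < dq + df)%N.
Proof. by rewrite /df; lia. Qed.

Let col0 : 'I_(dq + df) := Ordinal d_gt0.

Let Sylvester_rowpoly i j : Sylvester_mx f q i j = (rowpoly i)`_j.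
Proof.
rewrite Sylvester_mxE /rowpoly; case: split => k;
by rewrite coefXnM ltnNge if_neg -mulrb.
Qed.

Let size_rowpoly i : (size (rowpoly i) <= dq + df)%N.
Proof.
rewrite /rowpoly; case: split => k; apply: leq_trans (size_polyMleq _ _) _;
rewrite size_polyXn; have := ltn_ord k; rewrite /dq /df; lia.
Qed.

Let rowpoly_horner i : (rowpoly i).[a] = p%:Z * rowval i.
Proof.
by rewrite /rowpoly /rowval; case: split => k; rewrite !hornerE ?fa ?qa /=; ring.
Qed.

Let M : 'M[int]_(dq + df) :=
  \matrix_(i, j) if j == col0 then rowval i else (rowpoly i)`_j.

(* The columns of the Sylvester matrix are indexed by monomials; replacing the
   constant column by the evaluation at a is unimodular and makes it divisible
   by p. *)
Let resultantE : resultant f q = p%:Z * \det M.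
Proof.
pose E : 'M[int]_(dq + df) := \matrix_(i, j) if j == col0 then a ^+ i else (i == j)%:R.
pose D : 'rV[int]_(dq + df) := \row_j if j == col0 then p%:Z else 1.
have SE : Sylvester_mx f q *m E = M *m diag_mx D.
  apply/matrixP => i j; rewrite mul_mx_diag !mxE; case: eqVneq => [->|j0].
    rewrite mulrC -rowpoly_horner (horner_coef_wide _ (size_rowpoly i)).
    by apply: eq_bigr => k _; rewrite Sylvester_rowpoly [E _ _]mxE eqxx.
  rewrite (bigD1 j) //= big1 => [|k kj]; last first.
    by rewrite [E _ _]mxE (negbTE j0) (negbTE kj) mulr0.
  by rewrite [E _ _]mxE (negbTE j0) eqxx Sylvester_rowpoly !mulr1 addr0.
have /(congr1 determinant) := SE; rewrite !det_mulmx det_diag.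
rewrite (bigD1 col0) //= big1 => [|k /negbTE k0]; last by rewrite mxE k0.
have -> : \det E = 1.
  rewrite det_trig.
    apply: big1 => k _; rewrite mxE; case: eqP => [->|]; last by rewrite eqxx.
    by rewrite expr0.
  apply/is_trig_mxP => i j ij; rewrite mxE ifN.
    by rewrite (_ : i == j = false) //; apply/eqP=> ji; move: ij; rewrite ji ltnn.
  by apply/eqP => j0; move: ij; rewrite j0.
by rewrite /resultant mxE eqxx !mulr1 mulrC => ->.
Qed.

Let sum_rowpoly (w : 'rV['F_p]_(dq + df)) :
  \sum_i w 0 i *: map_poly phi (rowpoly i) =
  rVpoly (lsubmx w) * map_poly phi f + rVpoly (rsubmx w) * map_poly phi q.
Proof.
rewrite big_split_ord !rVpoly_sum !mulr_suml /=; congr (_ + _);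
apply: eq_bigr => k _; rewrite mxE -scalerAl; congr (_ *: _);
by rewrite /rowpoly (unsplitK (inl k), unsplitK (inr k)) rmorphM /= map_polyXn.
Qed.

Let sum_rowval (w : 'rV['F_p]_(dq + df)) :
  \sum_i w 0 i * phi (rowval i) =
  (rVpoly (lsubmx w)).[phi a] * phi alpha + (rVpoly (rsubmx w)).[phi a] * phi beta.
Proof.
rewrite big_split_ord !rVpoly_sum !horner_sum !mulr_suml /=; congr (_ + _);
apply: eq_bigr => k _; rewrite mxE !hornerE;
by rewrite /rowval (unsplitK (inl k), unsplitK (inr k)) rmorphM /= rmorphXn /= mulrA.
Qed.

(** By [resultantE], p^2 divides the resultant exactly when [M] is singular mod p. The two halves of
    a left kernel vector are the coefficients of [u] and [v]; the replaced column of [M] yields the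
    relation at [a], the other columns the polynomial relation. *)
Lemma dvd_resultant_sqr :
  ((p ^ 2)%:Z %| resultant f q)%Z <->
  exists u v : {poly 'F_p},
    [/\ (u != 0) || (v != 0), (size u <= (size q).-1)%N, (size v <= (size f).-1)%N,
        u * map_poly (intr : int -> 'F_p) f + v * map_poly (intr : int -> 'F_p) q = 0
      & u.[a%:~R] * alpha%:~R + v.[a%:~R] * beta%:~R = 0].
Proof.
have p0 : p%:Z != 0 by case: (p) pP.
have fa0 : (map_poly phi f).[phi a] = 0.
  by rewrite horner_map fa rmorphM /= -pmulrn pchar_Fp_0 // mul0r.
have qa0 : (map_poly phi q).[phi a] = 0.
  by rewrite horner_map qa rmorphM /= -pmulrn pchar_Fp_0 // mul0r.
rewrite resultantE -mulnn PoszM dvdz_mul2l // dvdz_Fp //.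
have kerE (w : 'rV['F_p]_(dq + df)) : w *m map_mx phi M = 0 <->
    rVpoly (lsubmx w) * map_poly phi f + rVpoly (rsubmx w) * map_poly phi q = 0 /\
    (rVpoly (lsubmx w)).[phi a] * phi alpha + (rVpoly (rsubmx w)).[phi a] * phi beta = 0.
  rewrite -sum_rowpoly -sum_rowval; set P := \sum_i _ *: _; set V := \sum_i _.
  have wM j : (w *m map_mx phi M) 0 j = if j == col0 then V else P`_j.
    rewrite mxE; case: ifP => j0.
      by apply: eq_bigr => i _; rewrite !mxE j0.
    by rewrite coef_sum; apply: eq_bigr => i _; rewrite !mxE j0 coefZ coef_map.
  have sizeP : (size P <= dq + df)%N.
    apply: leq_trans (size_sum _ _ _) _; apply/bigmax_leqP => i _.
    apply: leq_trans (size_scale_leq _ _) _.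
    exact: leq_trans (size_poly _ _) (size_rowpoly i).
  split=> [wM0|[P0 V0]]; last first.
    by apply/rowP => j; rewrite wM mxE P0 V0 coef0 if_same.
  have V0 : V = 0 by have := wM col0; rewrite eqxx wM0 mxE.
  split=> //.
  have coefP k : (0 < k)%N -> P`_k = 0.
    case: (ltnP k (dq + df)) => [kd k0|dk _]; last first.
      by rewrite nth_default // (leq_trans sizeP).
    by have := wM (Ordinal kd); rewrite wM0 mxE -val_eqE /= gtn_eqF // => <-.
  (* The constant coefficient has no column of its own in [M]; it vanishes because [f] and [q] are
     zero at [a] mod p. *)
  have PC : P = (P`_0)%:P.
    by apply/polyP => -[|k]; rewrite coefC //= coefP.
  have: P.[phi a] = 0.
    by rewrite /P sum_rowpoly hornerD !hornerM fa0 qa0 !mulr0 addr0.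
  by rewrite PC hornerC => ->.
have -> : ((\det M)%:~R : 'F_p) = \det (map_mx phi M) by rewrite -det_map_mx.
split=> [/det0P[w w0 /kerE[P0 V0]]|[u [v [uv0 su sv P0 V0]]]].
  exists (rVpoly (lsubmx w)), (rVpoly (rsubmx w)); split; rewrite ?size_poly //.
  apply: contraNT w0; rewrite negb_or !negbK => /andP[/eqP wl /eqP wr].
  by rewrite -[w]hsubmxK -[lsubmx w]rVpolyK -[rsubmx w]rVpolyK wl wr !linear0 row_mx0.
apply/det0P; exists (row_mx (poly_rV u) (poly_rV v)); last first.
  by apply/kerE; rewrite row_mxKl row_mxKr !poly_rV_K.
apply: contraTneq uv0 => w0; rewrite negb_or !negbK -(poly_rV_K su) -(poly_rV_K sv).
have [-> ->] : poly_rV u = 0 :> 'rV_dq /\ poly_rV v = 0 :> 'rV_df.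
  by apply: eq_row_mx; rewrite w0 row_mx0.
by rewrite !linear0 eqxx.
Qed.

End ResultantModSquare.

(** * Weak divisibility *)

(* With F = (X - r)^2 h, dividing the relation by X - r leaves
   u (X - r) h + v (2 h + (X - r) h') = 0, whose coefficients are coprime. *)
Lemma double_root_syzygy (L : closedFieldType) (F u v : {poly L}) (r : L) :
    (2%:R : L) != 0 -> F != 0 -> mup r F = 2 ->
    (forall x, (2 <= mup x F)%N -> x = r) ->
    u * F + v * F^`() = 0 -> (size v <= (size F).-1)%N ->
  v.[r] = 0 /\ (u.[r] = 0 -> u = 0 /\ v = 0).
Proof.
move=> two0 F0 mF uniqF uvF sv.
have [h Fh] : exists h : {poly L}, F = h * ('X - r%:P) ^+ 2.
  by apply/dvdpP; rewrite -mup_geq // mF.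
set y := 'X - r%:P in Fh; have y0 : y != 0 by rewrite polyXsubC_eq0.
have h0 : h != 0 by apply: contraNneq F0 => h0; rewrite Fh h0 mul0r.
have hr : h.[r] != 0.
  apply/negP => /factor_theorem[k hk].
  have : (3 <= mup r F)%N by rewrite mup_geq // Fh hk -mulrA -exprS dvdp_mulIr.
  by rewrite mF.
pose h1 := 2%:R *: h + y * h^`().
have F'E : F^`() = y * h1.
  rewrite Fh derivM deriv_exp derivXsubC /h1 -mul_polyC -[_%:P]/(2%:R%:P).
  by rewrite polyCMn; ring.
have cop : coprimep (y * h) h1.
  (* At [r], [h1] takes the value 2 h(r), which is nonzero. At any other root z of [h], a zero of
     [h1] would be a zero of h', making z a second multiple root of [F]. *)
  apply: Pdiv.ClosedField.root_coprimep => z; rewrite rootM root_XsubC.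
  have h1z : h1.[z] = 2%:R * h.[z] + (z - r) * h^`().[z] by rewrite !hornerE.
  rewrite h1z; case: eqVneq => [-> _|zr /= hz]; first by rewrite subrr mul0r addr0 mulf_neq0.
  rewrite (rootP hz) mulr0 add0r mulf_neq0 ?subr_eq0 //.
  apply: contra zr => h'z; apply/eqP/uniqF; rewrite mup_geq // Fh dvdp_mulr //.
  have /factor_theorem[k hk] := hz.
  move: h'z; rewrite hk derivM derivXsubC mulr1 !hornerE subrr mulr0 add0r.
  by move/factor_theorem=> [k' ->]; rewrite -mulrA -expr2 dvdp_mulIr.
have uv : y * (u * (y * h) + v * h1) = 0.
  by rewrite -uvF F'E Fh; ring.
have {}uv : u * (y * h) + v * h1 = 0.
  by move/eqP: uv; rewrite mulf_eq0 (negbTE y0) => /eqP.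
have [w vw] : exists w : {poly L}, v = w * (y * h).
  apply/dvdpP; rewrite -(Gauss_dvdpl _ cop); apply/dvdpP; exists (- u).
  by rewrite mulNr; apply/eqP; rewrite -addr_eq0 addrC uv.
have sF : size F = (size h).+2.
  by rewrite Fh /y size_Mmonic ?monic_exp ?monicXsubC // size_exp_XsubC addn3.
(* The degree bound on [v] equals deg (y h), so [w] is constant. *)
have /size1_polyC wc : (size w <= 1)%N.
  have [->|w0] := eqVneq w 0; first by rewrite size_poly0.
  move: sv; rewrite vw sF size_mul ?mulf_neq0 // mulrC size_mul //.
  rewrite (size_XsubC r : size y = 2%N); have : (0 < size h)%N by rewrite size_poly_gt0.
  by move: (size w) (size h) => a b; lia.
have uE : u = - (w * h1).
  apply: (mulIf (mulf_neq0 y0 h0)); apply/eqP; rewrite mulNr -addr_eq0.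
  by rewrite mulrAC -vw uv.
split; first by rewrite vw !hornerM hornerXsubC subrr mul0r mulr0.
(* Hence u(r) vanishes only when the constant [w] does. *)
have ur : u.[r] = - (w`_0 * (2%:R * h.[r])).
  rewrite uE {1}wc hornerN hornerM hornerC hornerD hornerZ hornerM hornerXsubC.
  by rewrite subrr mul0r addr0.
rewrite ur => /eqP; rewrite oppr_eq0 !mulf_eq0 (negbTE two0) (negbTE hr) !orbF.
move=> /eqP w0; have {}w0 : w = 0 by rewrite wc w0.
by rewrite uE vw w0 !mul0r oppr0.
Qed.

Section WeakDivisibility.
Variables (p : nat) (f : {poly int}) (l : int).
Hypotheses (pP : prime p) (fM : f \is monic).
Hypothesis fl : (2 <= mult_mod f (Fp_to_Fpbar p l%:~R))%N.

Let phi : {rmorphism int -> 'F_p} := intr.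
Let Fbar := map_poly (Fp_to_Fpbar p) (map_poly phi f).

Let Fbar_monic : Fbar \is monic.
Proof. by rewrite !monic_map. Qed.

Let dvd_root (h : {poly int}) :
  root (map_poly (Fp_to_Fpbar p) (map_poly phi h)) (Fp_to_Fpbar p l%:~R) =
  (p%:Z %| h.[l])%Z.
Proof. by rewrite /root horner_map fmorph_eq0 horner_map dvdz_Fp. Qed.

Lemma multiple_root_dvd : (p%:Z %| f.[l])%Z && (p%:Z %| f^`().[l])%Z.
Proof.
rewrite -!dvd_root -!deriv_map -/Fbar.
move: fl; rewrite /mult_mod -/Fbar mup_geq ?monic_neq0 // => /dvdpP[h ->].
rewrite derivM deriv_exp derivXsubC mul1r expr1 expr2 /root !hornerM hornerXsubC.
by rewrite hornerD !hornerM hornerMn hornerXsubC subrr mul0rn !mulr0 addr0 eqxx.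
Qed.

(** Write f(l) = p alpha. The resultant criterion gives a nonzero pair (u, v), and the syzygy lemma,
    applied over the algebraic closure, gives v(l) = 0. The remaining relation is u(l) alpha = 0 mod
    p; if alpha were nonzero mod p, then u(l) = 0 would force u = v = 0. *)
Lemma weakly_divides_sqr_dvd :
  odd p -> (1 < size f)%N -> weakly_divides p f -> ((p ^ 2)%:Z %| f.[l])%Z.
Proof.
move=> pO f_gt1 [dvd_disc [r [mr uniq_r]]].
have /andP[/dvdzP[alpha fla] /dvdzP[beta flb]] := multiple_root_dvd.
rewrite mulrC in fla; rewrite mulrC in flb.
have rl : Fp_to_Fpbar p r = Fp_to_Fpbar p l%:~R by rewrite -(uniq_r _ fl).
have : ((p ^ 2)%:Z %| resultant f f^`())%Z.
  by move: dvd_disc; rewrite /discr -signr_odd rpredMsign.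
case/(dvd_resultant_sqr pP f_gt1 fla flb) => u [v [uv0 _ sv uv rel]].
rewrite fla -mulnn PoszM dvdz_mul2l; last by case: (p) pP.
rewrite dvdz_Fp //; apply/eqP; apply/eqP; apply: contraTT uv0 => alpha0.
pose mapK := map_poly (Fp_to_Fpbar p).
have [||||||vl ul] := @double_root_syzygy _ Fbar (mapK u) (mapK v) (Fp_to_Fpbar p l%:~R).
- rewrite -(rmorph_nat (Fp_to_Fpbar p)) fmorph_eq0 -(rmorph_nat phi) -dvdz_Fp //.
  apply/negP; rewrite dvdzE /= => /(dvdn_leq (ltn0Sn 1)).
  by have := prime_gt1 pP; move: pO; case: (p) => [|[|[|]]].
- exact: monic_neq0.
- by rewrite -rl.
- by move=> x; rewrite -rl; apply: uniq_r.
- by rewrite /Fbar !deriv_map -!rmorphM -rmorphD /= uv rmorph0.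
- rewrite /mapK size_map_poly /Fbar size_map_poly size_map_poly_id0 //.
  by rewrite (monicP fM) rmorph1 oner_eq0.
have v0 : v.[l%:~R] = 0.
  by apply/eqP; rewrite -(fmorph_eq0 (Fp_to_Fpbar p)) -horner_map vl.
move/eqP: rel; rewrite v0 mul0r addr0 mulf_eq0 (negbTE alpha0) orbF => /eqP u0.
have [|] := ul; first by rewrite horner_map u0 rmorph0.
by move=> /eqP; rewrite map_poly_eq0 => -> /eqP; rewrite map_poly_eq0 => ->.
Qed.

End WeakDivisibility.

(** * Anti-bidiagonal matrices *)

(** [det_kernel_border] with the convertible sizes [1 + g] and [g.+1] exchanged and the first column
    written as a deletion. *)
Lemma det_kernel_form (R : comNzRingType) g (N : 'M[R]_(g, g.+1)) (S : 'M_g.+1)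
    (v : 'cV_g.+1) :
  N *m v = 0 ->
  v 0 0 ^+ 2 * \det (block_mx 0 N N^T S) =
  (-1) ^+ g * \det (col' 0 N) ^+ 2 * (v^T *m S *m v) 0 0.
Proof.
pose N' : 'M[R]_(g, 1 + g) := N; pose v' : 'cV[R]_(1 + g) := v.
have v'E : v' = col_mx (v 0 0)%:M (dsubmx v').
  rewrite -{1}[v']vsubmxK; congr col_mx; apply/matrixP => i j.
  by rewrite !ord1 !mxE; congr (v _ _); apply/val_inj.
have N'E : row_mx (lsubmx N') (rsubmx N') = N := hsubmxK N'.
have -> : col' 0 N = rsubmx N'.
  by apply/matrixP => i j; rewrite !mxE; congr (N _ _); apply/val_inj.
move=> Nv; have := @det_kernel_border R g (lsubmx N') (rsubmx N') S (v 0 0) (dsubmx v').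
by rewrite N'E -v'E; apply.
Qed.

Section AntiBidiagonal.
Variables (R : comNzRingType) (g : nat) (y : R) (b : nat -> R).

(** The common shape of the top-right block of X A_0 - B and of the pencil whose minors define
    [Q]. *)
Definition antibidiag : 'M[R]_(g, g.+1) :=
  \matrix_(i, j) (y *+ (i + j == g)%N - b i *+ ((i + j).+1 == g)%N).

Lemma antibidiag_mulmx (v : nat -> R) (i : 'I_g) :
  \sum_j antibidiag i j * v j = y * v (g - i)%N - b i * v (g - i.+1)%N.
Proof.
have ig := ltn_ord i.
have lt0 : (g - i < g.+1)%N by lia.
have lt1 : (g - i.+1 < g.+1)%N by lia.
under eq_bigr => j _ do rewrite mxE mulrBl.
rewrite big_split /= (bigD1 (Ordinal lt0)) //= subnKC ?eqxx 1?ltnW // mulr1n.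
rewrite big1 ?addr0 => [|j]; last first.
  by rewrite -val_eqE /= => ji; rewrite (_ : _ == g = false) ?mul0r //; lia.
congr (_ + _); rewrite (bigD1 (Ordinal lt1)) //= -addSn subnKC // eqxx mulr1n.
rewrite big1 ?addr0 // => j; rewrite -val_eqE /= => ji.
by rewrite (_ : _ == g = false) ?mulr0n ?mul0r ?oppr0 //; lia.
Qed.

Lemma det_antibidiag :
  \det (col' 0 antibidiag) = (-1) ^+ perm (@rev_ord_inj g) * y ^+ g.
Proof.
rewrite det_antitrig => [|i j ij]; last first.
  rewrite !mxE /= /bump /= (_ : _ == g = false); last by lia.
  by rewrite (_ : _ == g = false) ?subr0 //; lia.
congr (_ * _); rewrite -[in RHS](card_ord g) -prodr_const; apply: eq_bigr => i _.
rewrite !mxE /= /bump /=; have := ltn_ord i => ig.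
rewrite (_ : _ == g = true); last by lia.
by rewrite (_ : _ == g = false) ?subr0 //; lia.
Qed.

End AntiBidiagonal.

(** The signed minors mu_j lie in the kernel, so row g - j - 1 reads y mu_(j+1) = b_(g-j-1) mu_j.
    Cancelling [y] determines all of them from mu_0. *)
Lemma antibidiag_minors (R : idomainType) g (y : R) (b c : nat -> R) :
    y != 0 -> c 0%N = 1 ->
    (forall j, (j < g)%N -> c j.+1 = b (g - j.+1)%N * c j) ->
  forall j : 'I_g.+1, (-1) ^+ j * \det (col' j (antibidiag g y b)) =
    (-1) ^+ perm (@rev_ord_inj g) * (c j * y ^+ (g - j)).
Proof.
move=> y0 c0 cS; have := det_antibidiag g y b; move: ((-1) ^+ perm _ : R) => s det0.
move=> [j jg]; elim: j jg => [|j IHj] jg.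
  have -> : Ordinal jg = 0 by apply/val_inj.
  by rewrite det0 c0 subn0 expr0 !mul1r.
have lt0 : (g - j.+1 < g)%N by lia.
have := signed_minors_kernel (antibidiag g y b) (Ordinal lt0).
pose mu (k : nat) : R := (-1) ^+ k * \det (col' (inord k) (antibidiag g y b)).
under eq_bigr => k _.
  rewrite (_ : _ * \det _ = mu k); last by rewrite /mu inord_val.
  over.
rewrite antibidiag_mulmx /= subKn // (_ : g - (g - j.+1).+1 = j)%N; last by lia.
move/eqP; rewrite subr_eq0 => /eqP.
have jg' : (j < g.+1)%N by lia.
rewrite /mu (_ : inord j.+1 = Ordinal jg); last by apply/val_inj; rewrite /= inordK.
rewrite (_ : inord j = Ordinal jg'); last by apply/val_inj; rewrite /= inordK.
rewrite IHj => E; apply: (mulfI y0); rewrite E cS //.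
by rewrite (_ : g - j = (g - j.+1).+1)%N /=; [rewrite exprS; ring|lia].
Qed.

(** Diagonal positions have index sum 2i and neighbouring ones 2i + 1, so each k up to 2g occurs
    exactly once. Raising [g] by one adds the terms 2g + 1 and 2g + 2. *)
Lemma tridiagonal_form (R : comNzRingType) (T : nat -> nat -> R) (w t : nat -> R) g :
    (forall i, T i i * (w i * w i) = t (i + i)%N) ->
    (forall i, (T i i.+1 + T i.+1 i) * (w i * w i.+1) = t (i + i.+1)%N) ->
    (forall i j, (i.+1 < j)%N || (j.+1 < i)%N -> T i j = 0) ->
  \sum_(i < g.+1) \sum_(j < g.+1) T i j * (w i * w j) = \sum_(k < (g + g).+1) t k.
Proof.
move=> Td To T0; elim: g => [|g IHg].
  by rewrite !big_ord_recl !big_ord0 !addr0 Td.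
have lastE (F : nat -> R) : (forall i, (i < g)%N -> F i = 0) ->
    \sum_(i < g.+1) F i = F g.
  move=> F0; rewrite big_ord_recr /= big1 ?add0r // => i _; exact: F0.
rewrite addSn addnS [in RHS]big_ord_recr [in RHS]big_ord_recr /= -IHg.
rewrite [LHS]big_ord_recr /=; under eq_bigr do rewrite big_ord_recr /=.
rewrite big_split /= [X in _ + X]big_ord_recr /= -!addrA; congr (_ + _).
rewrite (lastE (fun i => T i g.+1 * (w i * w g.+1))); last first.
  by move=> i ig; rewrite T0 ?mul0r // !ltnS ig.
rewrite (lastE (fun j => T g.+1 j * (w g.+1 * w j))); last first.
  by move=> i ig; rewrite T0 ?mul0r // !ltnS ig orbT.
have := To g; have := Td g.+1; rewrite addSn !addnS => <- <-; ring.
Qed.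

(** * The matrix attached to a polynomial *)

(** As n is odd, the antidiagonal meets the bottom-right block only in its corner. *)
Lemma A0_block g :
  A0 g = block_mx 0 (\matrix_(i, j) (i + j == g)%N%:R)
                  (\matrix_(i, j) (i + j == g)%N%:R)^T (delta_mx 0 0).
Proof.
apply/matrixP => i j; rewrite !mxE -val_eqE /=.
case: splitP => i' ->; rewrite mxE; case: splitP => j' ->; rewrite !mxE.
- by rewrite (_ : _ == _ = false) //; have := ltn_ord i'; have := ltn_ord j'; lia.
- by congr (nat_of_bool _)%:R; have := ltn_ord i'; have := ltn_ord j'; lia.
- by congr (nat_of_bool _)%:R; have := ltn_ord i'; have := ltn_ord j'; lia.
- by congr (nat_of_bool _)%:R; rewrite -!val_eqE /=; have := ltn_ord i'; lia.
Qed.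

Lemma A0_sqr g : A0 g *m A0 g = 1%:M.
Proof.
apply/matrixP => i j; rewrite !mxE (bigD1 (rev_ord i)) //= big1 ?addr0.
  by rewrite !mxE eqxx mul1r rev_ordK eq_sym.
by move=> k /negbTE ki; rewrite !mxE ki mul0r.
Qed.

(** [A0] is an involution, so X A_0 - B = A_0 (X - A_0 B). This gives the degree of [fB B] and, up
    to sign, its leading coefficient. *)
Lemma fB_char_poly g (B : 'M[rat]_(g + g.+1)) :
  fB B = ((-1) ^+ g * \det (A0 g))%:P * char_poly (A0 g *m B).
Proof.
rewrite /fB /char_poly /char_poly_mx polyCM rmorphXn rmorphN1 -mulrA.
congr (_ * _); rewrite -det_map_mx -det_mulmx mulmxBr -map_mxM mulmxA A0_sqr mul1mx.
by rewrite mul_mx_scalar.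
Qed.

Lemma size_fB g (B : 'M[rat]_(g + g.+1)) : size (fB B) = (g + g.+1).+1.
Proof.
rewrite fB_char_poly size_Cmul ?size_char_poly // mulf_neq0 ?signr_eq0 //.
apply/eqP => d0; have := congr1 determinant (A0_sqr g).
by rewrite det_mulmx d0 mul0r det1 => /eqP; rewrite eq_sym oner_eq0.
Qed.

Section SectionMatrix.
Variables (g m : nat) (l : int) (a : nat -> int).
Hypotheses (g_gt0 : (0 < g)%N) (m_gt0 : (0 < m)%N).

(** Generic in the ring because it is needed over the rationals and over polynomials in one and two
    variables. *)
Definition super_entry (R : nzRingType) (i : nat) : R := if i == 0%N then m%:R else 1.

(* The truncated exponent 2 - (i + j) divides a_0 by m^2, a_1 by m, and no other
   coefficient. *)
Definition tridiag_entry (i j : nat) : rat :=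
  let d := (a (i + j))%:~R / m%:R ^+ (2 - (i + j)) in
  if i == j then d
  else if (i == j.+1) || (j == i.+1) then d / 2%:R else 0.

(** The tridiagonal block is reversed because the kernel vector lists decreasing powers of X - l,
    and negated because B enters [fB] with a minus sign. *)
Definition section_mx : 'M[rat]_(g + g.+1) :=
  let N : 'M_(g, g.+1) :=
    \matrix_(i, j) (super_entry rat i *+ ((i + j).+1 == g)%N) in
  block_mx 0 N N^T (\matrix_(i, j) (- tridiag_entry (g - i) (g - j)))
  + l%:~R *: A0 g.

Let m_neq0 : m%:R != 0 :> rat.
Proof. by rewrite pnatr_eq0 -lt0n. Qed.

Let tridiag_entryC i j : tridiag_entry i j = tridiag_entry j i.
Proof. by rewrite /tridiag_entry addnC eq_sym orbC. Qed.

Let polyC_super_entry (R : nzRingType) i : (super_entry R i)%:P = super_entry {poly R} i.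
Proof. by rewrite /super_entry; case: ifP; rewrite ?polyC_natr ?polyC1. Qed.

Lemma section_mx_in_W0 : in_W0 section_mx.
Proof.
split; rewrite /section_mx A0_block scale_block_mx add_block_mx scaler0 addr0.
  rewrite tr_block_mx trmx0 !linearD !linearZ /= !trmxK trmx_delta.
  congr (block_mx _ _ _ (_ + _)).
  by apply/matrixP => i j; rewrite !mxE tridiag_entryC.
by rewrite block_mxKul.
Qed.

(** The only denominators other than 1 and 2 are in a_0 / m^2 on the diagonal and a_1 / (2m) next to
    it. *)
Lemma section_mx_half_integral :
  (m%:Z %| a 1)%Z -> ((m ^ 2)%:Z %| 2 * a 0)%Z -> in_half_W0Z section_mx.
Proof.
move=> /dvdzP[a1 Ea1] /dvdzP[a0 Ea0]; split; first exact: section_mx_in_W0.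
have tridiag_int i j : 2%:R * tridiag_entry i j \is a Num.int.
  rewrite /tridiag_entry; case: eqP => [->|_].
    case: j => [|j].
      rewrite mulrA; have -> : 2%:R * (a 0)%:~R = (2 * a 0)%:~R :> rat by rewrite intrM.
      rewrite Ea0 intrM PoszM !intrM -!pmulrn subn0 expr2.
      by rewrite mulfK ?mulf_neq0 // intr_int.
    rewrite (_ : 2 - _ = 0)%N; last by lia.
    by rewrite expr0 divr1 rpredM ?intr_int ?natr_int.
  case: ifP => [ij|_]; last by rewrite mulr0 rpred0.
  rewrite mulrC divfK // ; case E: (i + j)%N => [|[|k]].
  - by move: ij E; case: i j => [|i] [|j].
  - by rewrite Ea1 intrM subSS subn0 expr1 mulfK // intr_int.
  - by rewrite expr0 divr1 intr_int.
have super_int i : super_entry rat i \is a Num.int.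
  by rewrite /super_entry; case: ifP; rewrite ?natr_int ?rpred1.
move=> i j; rewrite !mxE mulrDr rpredD //; last by rewrite !rpredM ?intr_int ?natr_int.
case: split => i'; rewrite mxE; case: split => j'; rewrite !mxE ?mulr0 ?rpred0 //.
- by rewrite rpredM // rpredMn.
- by rewrite rpredM // rpredMn.
- by rewrite mulrN rpredN tridiag_int.
Qed.

Lemma fB_section_mx :
  fB section_mx =
  ('X - (l%:~R)%:P) ^+ (g + g).+1
  + \sum_(k < (g + g).+1) (a k)%:~R%:P * ('X - (l%:~R)%:P) ^+ k.
Proof.
set y : {poly rat} := 'X - (l%:~R)%:P.
pose T i j : {poly rat} := (tridiag_entry i j)%:P.
pose b i : {poly rat} := super_entry {poly rat} i.
pose N := antibidiag g y b.
pose S : 'M[{poly rat}]_g.+1 :=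
  \matrix_(i, j) (y *+ ((i == 0) && (j == 0)) + T (g - i)%N (g - j)%N).
have ME : 'X *: map_mx polyC (A0 g) - map_mx polyC section_mx = block_mx 0 N N^T S.
  have -> : 'X *: map_mx polyC (A0 g) - map_mx polyC section_mx =
     y *: map_mx polyC (A0 g) - map_mx polyC (section_mx - l%:~R *: A0 g).
    apply/matrixP => i j; rewrite !mxE !(polyCD, polyCN, polyCM) /y; ring.
  rewrite /section_mx addrK A0_block !map_block_mx scale_block_mx opp_block_mx.
  rewrite add_block_mx !raddf0 ?scaler0 ?oppr0 addr0; congr block_mx.
  + by apply/matrixP => i j; rewrite !mxE polyC_natr mulr_natr polyCMn polyC_super_entry.
  + by apply/matrixP => i j; rewrite !mxE polyC_natr mulr_natr polyCMn polyC_super_entry.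
  + apply/matrixP => i j; rewrite !mxE polyCN opprK /T; congr (_ + _).
    by case: andP => _; rewrite ?mulr1 ?mulr0.
(* Row i of [N] demands y w_i = b_i w_(i+1); as b_0 = m and w_1 = y, the entry w_0 has to be m
   instead of 1. *)
pose w (k : nat) : {poly rat} := if k == 0%N then m%:R else y ^+ k.
pose v : 'cV[{poly rat}]_g.+1 := \col_j w (g - j)%N.
have Nv : N *m v = 0.
  apply/matrixP => i o; rewrite !mxE.
  under eq_bigr => j _ do rewrite [v _ _]mxE.
  rewrite (antibidiag_mulmx y b (fun j => w (g - j)%N)).
  have ig := ltn_ord i.
  rewrite subKn 1?ltnW // subKn // /b /super_entry /w /=.
  by case: (nat_of_ord i) => [|k] /=; rewrite ?expr1 -?exprS ?mul1r 1?mulrC subrr.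
have y0 : y != 0 by rewrite polyXsubC_eq0.
have := det_kernel_form S Nv; rewrite -ME det_antibidiag mxE subn0.
have -> : w g = y ^+ g by rewrite /w gtn_eqF.
rewrite exprMn sqrr_sign mul1r => E.
(* The factor y^(2g) cancels: on one side it is the square of the first entry of [v], on the other
   that of the minor of [N]. *)
have {}E : fB section_mx = (v^T *m S *m v) 0 0.
  have yg0 : y ^+ g ^+ 2 != 0 by rewrite !expf_neq0.
  by apply: (mulfI yg0); rewrite /fB mulrCA E -mulrA signrMK.
rewrite E !mxE.
(* The corner entry of A_0 contributes y times y^(2g), the leading term. *)
have -> : \sum_j (v^T *m S) 0 j * v j 0 =
   y * (w g * w g) +
   \sum_(i < g.+1) \sum_(j < g.+1) T (g - i)%N (g - j)%N * (w (g - i)%N * w (g - j)%N).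
  rewrite exchange_big /=.
  transitivity (\sum_(j < g.+1) \sum_(i < g.+1)
       y *+ ((i == 0) && (j == 0)) * (w (g - i)%N * w (g - j)%N) +
     \sum_(j < g.+1) \sum_(i < g.+1)
       T (g - i)%N (g - j)%N * (w (g - i)%N * w (g - j)%N)).
    rewrite -big_split; apply: eq_bigr => j _; rewrite !mxE big_distrl -big_split.
    by apply: eq_bigr => i _ /=; rewrite !mxE; ring.
  congr (_ + _).
  rewrite big_ord_recl big_ord_recl /= subn0 big1 => [|i _]; last by rewrite mul0r.
  by rewrite addr0 big1 ?addr0 // => j _; rewrite big1 // => i _; rewrite andbF mul0r.
congr (_ + _).
  by rewrite /w gtn_eqF // -exprD -exprS.
rewrite (reindex_inj rev_ord_inj) /=.
under eq_bigr => i _.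
  rewrite (reindex_inj rev_ord_inj) /=.
  under eq_bigr => j _.
    rewrite !subSS !subKn -1?ltnS //.
    over.
  over.
apply: (tridiagonal_form (w := w) (t := fun k => (a k)%:~R%:P * y ^+ k)).
- case=> [|i]; rewrite /T /w /tridiag_entry eqxx /=.
    rewrite addn0 subn0 expr0 mulr1 -polyC_natr -!polyCM.
    by rewrite -expr2 divfK // expf_neq0.
  rewrite (_ : 2 - _ = 0)%N; last by lia.
  by rewrite expr0 divr1 -exprD.
- move=> i; rewrite {1}/T tridiag_entryC -/(T _ _) -mulr2n /T /tridiag_entry.
  rewrite gtn_eqF // eqxx /= [(_ + i)%N]addnC -polyCMn -[_ *+ 2]mulr_natr.
  rewrite divfK //; case: i => [|i]; rewrite /w /=.
    by rewrite expr1 -polyC_natr mulrA -polyCM divfK //.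
  rewrite (_ : 2 - _ = 0)%N; last by lia.
  by rewrite expr0 divr1 -exprD.
- by move=> i j ij; rewrite /T /tridiag_entry !ifF ?polyC0 //; lia.
Qed.

(** Up to a common sign, form j is mu_j Y^j (X - l Y)^(g - j). Its X-degree is g - j with leading
    coefficient mu_j Y^j, so the coefficient matrix is triangular with the mu_j on the diagonal. *)
Lemma Q_section_mx : `|Q section_mx| = m%:R.
Proof.
pose Y : {poly {poly rat}} := 'X%:P.
pose y : {poly {poly rat}} := 'X - (l%:~R *: 'X)%:P.
pose b i := Y * super_entry {poly {poly rat}} i.
have WE : 'X *: map_mx (fun c : rat => c%:P%:P) (ursubmx (A0 g)) -
    'X%:P *: map_mx (fun c : rat => c%:P%:P) (ursubmx section_mx) = antibidiag g y b.
  rewrite /section_mx A0_block scale_block_mx add_block_mx !block_mxKur.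
  apply/matrixP => i j; rewrite !mxE /b /y -mul_polyC !polyCD !polyCM !polyCMn.
  by rewrite !polyC_super_entry !polyC1; ring.
(* The product of b_(g-1), ..., b_(g-j) picks up b_0, and with it m, only at j = g. *)
pose mu (j : nat) : rat := if j == g then m%:R else 1.
pose c j := Y ^+ j * (mu j)%:P%:P.
have y0 : y != 0 by rewrite polyXsubC_eq0.
have c0 : c 0%N = 1 by rewrite /c /mu ltn_eqF // !polyC1 mulr1.
have cS j : (j < g)%N -> c j.+1 = b (g - j.+1)%N * c j.
  move=> jg; rewrite /c /b /mu /super_entry exprS (ltn_eqF jg) subn_eq0.
  rewrite (_ : (g <= j.+1)%N = (j.+1 == g)); last by lia.
  by case: ifP => _; rewrite ?polyC_natr ?polyC1; ring.
have [e [norm_e minors]] : exists e : rat, `|e| = 1 /\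
    forall j : 'I_g.+1, (-1) ^+ j * \det (col' j (antibidiag g y b)) =
      e%:P%:P * (c j * y ^+ (g - j)).
  exists ((-1) ^+ perm (@rev_ord_inj g)); rewrite normrX normrN1 expr1n; split=> // j.
  by rewrite !polyC_exp !polyCN !polyC1; apply: antibidiag_minors.
rewrite /Q /Qpair /minor_form WE; set M := \matrix_(i, k) _.
have ME (i k : 'I_g.+1) :
    M i k = ((e * mu i) *: 'X^i * (y ^+ (g - i))`_(g - k))`_k.
  rewrite mxE minors -coefCM; set lhs := _ * (c i * _); set rhs := _%:P * _.
  suff -> : lhs = rhs by [].
  by rewrite /lhs /rhs /c -mul_polyC !polyCM !polyC_exp; ring.
have ME0 (i k : 'I_g.+1) : (k < i)%N -> M i k = 0.
  move=> ki; rewrite ME [(y ^+ _)`_ _]nth_default ?mulr0 ?coef0 //.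
  by rewrite /y size_exp_XsubC; have := ltn_ord i; lia.
have MEd (i : 'I_g.+1) : M i i = e * mu i.
  rewrite ME; have /monicP := monic_exp (g - i) (monicXsubC (l%:~R *: 'X : {poly rat})).
  by rewrite lead_coefE /y size_exp_XsubC /= => ->; rewrite mulr1 coefZ coefXn eqxx mulr1.
rewrite -det_tr det_trig; last by apply/is_trig_mxP => k i ki; rewrite mxE ME0.
rewrite normr_prod (bigD1 ord_max) //= big1 => [|i ig].
  by rewrite mxE MEd /mu eqxx normrM norm_e mul1r mulr1 normr_nat.
rewrite mxE MEd /mu ifN ?mulr1 // norm_e.
Qed.

End SectionMatrix.

(** * Strong divisibility *)

(** Here [c] stands for the power of 2 that clears the denominators of a half-integral matrix, a
    unit at odd p. *)
Lemma padic_val_ge_sqr (p c : nat) (x : rat) (z : int) :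
    prime p -> (0 < c)%N -> coprime p c -> c%:R * x = ((p ^ 2)%:Z * z)%:~R ->
  padic_val_ge p 2 x.
Proof.
move=> pP c_gt0 copc E.
have [->|x0] := eqVneq x 0; first by left.
right; have /(congr1 absz) : c%:Z * numq x = (p ^ 2)%:Z * z * denq x.
  by apply: (@intr_inj rat); rewrite intrM [RHS]intrM -E numqE -pmulrn mulrA.
rewrite !abszM !absz_nat => /(congr1 (logn p)).
have numx : (0 < `|numq x|)%N by rewrite absz_gt0 numq_eq0.
have denx : (0 < `|denq x|)%N by rewrite absz_gt0 denq_neq0.
have z_gt0 : (0 < `|z|)%N.
  rewrite absz_gt0; apply: contraNneq x0 => z0; move/eqP: E.
  by rewrite z0 mulr0 mulf_eq0 pnatr_eq0 eqn0Ngt c_gt0.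
have p2_gt0 : (0 < p ^ 2)%N by rewrite expn_gt0 prime_gt0.
have pz_gt0 : (0 < p ^ 2 * `|z|)%N by rewrite muln_gt0 p2_gt0.
rewrite (lognM p c_gt0 numx) (lognM p pz_gt0 denx) (lognM p p2_gt0 z_gt0).
rewrite (logn_coprime copc) lognX.
by rewrite (logn_prime p pP) eqxx; lia.
Qed.

Lemma resultantZ (R : fieldType) (c : R) (P q : {poly R}) :
    c != 0 ->
  resultant (c *: P) (c *: q) =
  c ^+ ((size q).-1 + (size P).-1) * resultant P q.
Proof.
move=> c0; rewrite /resultant /Sylvester_mx !size_scale // -detZ; congr (\det _).
by rewrite scale_col_mx; congr col_mx; apply/matrixP => i j; rewrite !mxE /= -scalerAr coefZ.
Qed.

Lemma map_resultant_int (P q : {poly int}) :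
  (resultant P q)%:~R =
  resultant (map_poly (intr : int -> rat) P) (map_poly (intr : int -> rat) q).
Proof.
rewrite /resultant /Sylvester_mx !size_map_inj_poly; try exact: intr_inj; try by [].
rewrite -[LHS]det_map_mx map_col_mx; congr (\det (col_mx _ _));
by apply: map_lin1_mx => v; rewrite map_poly_rV rmorphM /= map_rVpoly.
Qed.

Lemma size_deriv_int (F : {poly int}) : size F^`() = (size F).-1.
Proof.
have [->|F0] := eqVneq F 0; first by rewrite deriv0 size_poly0.
apply/eqP; rewrite eqn_leq -ltnS prednK ?size_poly_gt0 // lt_size_deriv //=.
case E: (size F) => [|[|n]] //=; rewrite ltnNge; apply/negP => sF'.
have /eqP := nth_default 0 sF'; rewrite coef_deriv mulrn_eq0 /=.
by have := lead_coef_eq0 F; rewrite lead_coefE E /= (negbTE F0) => ->.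
Qed.

(** The resultant criterion in the other direction. The condition on the leading coefficient keeps
    the degree of [F] mod p, hence the size bounds on the witnesses. *)
Lemma sqr_dvd_resultant_deriv (p : nat) (F D1 D2 D3 : {poly int}) (l : int) :
    prime p -> (1 < size F)%N -> ~~ (p%:Z %| lead_coef F)%Z ->
    F = p%:Z ^+ 2 *: D1 + p%:Z *: (('X - l%:P) * D2) + ('X - l%:P) ^+ 2 * D3 ->
  ((p ^ 2)%:Z %| resultant F F^`())%Z.
Proof.
move=> pP F_gt1 leadF FE.
pose phi : {rmorphism int -> 'F_p} := intr.
have p0 : phi p%:Z = 0 by rewrite /= -pmulrn pchar_Fp_0.
have Fl : F.[l] = p%:Z * (p%:Z * D1.[l]).
  by rewrite FE !hornerD !hornerZ !hornerM hornerXsubC subrr; ring.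
have F'l : F^`().[l] = p%:Z * (p%:Z * D1^`().[l] + D2.[l]).
  have -> : F^`() = p%:Z ^+ 2 *: D1^`() + p%:Z *: (D2 + ('X - l%:P) * D2^`()) +
                    ('X - l%:P) * (D3 *+ 2 + ('X - l%:P) * D3^`()).
    by rewrite FE !derivD !derivZ !derivM !derivXsubC -!mul_polyC; ring.
  rewrite hornerD [X in _ + X]hornerM hornerXsubC subrr mul0r addr0 hornerD !hornerZ.
  by rewrite hornerD hornerM hornerXsubC subrr; ring.
apply/(dvd_resultant_sqr pP F_gt1 Fl F'l).
pose H := map_poly phi D3; pose y : {poly 'F_p} := 'X - (phi l)%:P.
have Fbar : map_poly phi F = y ^+ 2 * H.
  have p20 : phi (p%:Z ^+ 2) = 0 by rewrite rmorphXn p0 expr0n.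
  rewrite FE !rmorphD /= !map_polyZ p20 p0 !scale0r !add0r [LHS]rmorphM.
  by congr (_ * _); rewrite rmorphXn /= map_polyXsubC.
have sF : size (map_poly phi F) = size F.
  by rewrite size_map_poly_id0 // -dvdz_Fp.
have y0 : y != 0 by rewrite polyXsubC_eq0.
have F0 : map_poly phi F != 0 by rewrite -size_poly_gt0 sF ltnW.
have yH0 : y * H != 0.
  by apply: contraNneq F0; rewrite Fbar expr2 -mulrA => ->; rewrite mulr0.
have sizeyM (q : {poly 'F_p}) : q != 0 -> size (y * q) = (size q).+1.
  by move=> q0; rewrite size_monicM ?monicXsubC // size_XsubC.
(* Mod p, F = y^2 H and F' = y u, so (u, -y H) is a syzygy. At l the second component vanishes, and
   F(l) / p is itself divisible by p. *)
pose u := H *+ 2 + y * H^`().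
have F'bar : map_poly phi F^`() = y * u.
  rewrite -deriv_map Fbar derivM deriv_exp derivXsubC mul1r expr1 /u; ring.
exists u, (- (y * H)); split.
- by rewrite oppr_eq0 yH0 orbT.
- have [->|u0] := eqVneq u 0; first by rewrite size_poly0.
  rewrite size_deriv_int -sF -ltnS -sizeyM // -F'bar -deriv_map.
  have := lt_size_deriv F0; rewrite sF; move: (size _) => k; lia.
- by rewrite size_polyN -sF Fbar expr2 -mulrA (sizeyM _ yH0).
- by rewrite -/phi F'bar Fbar; ring.
- by rewrite hornerN hornerM hornerXsubC subrr mul0r oppr0 mul0r addr0 intrM p0 mul0r mulr0.
Qed.

Section StrongDivisibility.
Variables (g p : nat) (B : 'M[rat]_(g.+1 + g.+2)) (l : int).
Hypotheses (pP : prime p) (pO : odd p) (BW0 : in_W0 B).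
Hypothesis B_int : forall i j, 2%:R * B i j \is a Num.int.
Hypothesis row_int :
  forall j, 2%:R * (B 0 j - l%:~R * A0 g.+1 0 j) / p%:R \is a Num.int.

Let k := (g + g.+2)%N.

(** X A_0 - B doubled to become integral; at an odd prime the powers of 2 are harmless. Its size is
    written [1 + k] to split off the first row and column. *)
Let M : 'M[{poly int}]_(1 + k) :=
  \matrix_(i, j) ('X *+ (2 * (j == rev_ord i)) - (numq (2%:R * B i j))%:P).

Let F : {poly int} := (-1) ^+ g.+1 * \det M.

Let map_F : map_poly (intr : int -> rat) F = 2%:R ^+ (1 + k) *: fB B.
Proof.
rewrite /F rmorphM rmorphXn rmorphN1 /fB scalerAr; congr (_ * _).
rewrite -det_map_mx -mul_polyC polyC_exp -detZ; congr (\det _).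
apply/matrixP => i j; rewrite !mxE rmorphB /= rmorphMn /= map_polyX map_polyC /=.
by rewrite numqK // polyCM !polyC_natr -mulr_natl natrM; ring.
Qed.

Let size_F : size F = k.+2.
Proof.
have := size_fB B; rewrite -(@size_scale _ (2%:R ^+ (1 + k))) ?expf_neq0 //.
by rewrite -map_F size_map_inj_poly //; exact: intr_inj.
Qed.

(** The leading coefficient is a power of 2 up to sign; squaring avoids computing the sign. *)
Let lead_F : ~~ (p%:Z %| lead_coef F)%Z.
Proof.
have lead_fB : lead_coef (fB B) ^+ 2 = 1.
  rewrite fB_char_poly mul_polyC lead_coefZ (monicP (char_poly_monic _)) mulr1.
  by rewrite exprMn sqrr_sign mul1r expr2 -det_mulmx A0_sqr det1.
have lead2 : lead_coef F ^+ 2 = (2 ^ (k.+1 * 2))%:Z.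
  apply: (@intr_inj rat); rewrite rmorphXn -lead_coef_map_inj; last 2 first.
  - exact: intr_inj.
  - by rewrite rmorph0.
  by rewrite map_F lead_coefZ exprMn lead_fB mulr1 -exprM -natrX.
apply/negP => /(dvdz_exp2r 2); rewrite lead2 => pd.
have : (p %| 2 ^ (k.+1 * 2))%N.
  by move: pd; rewrite dvdzE abszX !absz_nat; apply: dvdn_trans; rewrite dvdn_exp.
rewrite Euclid_dvdX // => /andP[/(dvdn_leq (ltn0Sn 1)) p2 _].
by have := prime_gt1 pP; move: pO p2; case: (p) => [|[|[|]]].
Qed.

(** By [row_int] the first row of [M] is p r1 + (X - l) r2 with r1 integral. Its corner is zero and
    its first column is the transpose, so bilinearity in the border applies. *)
Let F_expansion : exists D1 D2 D3,
  F = p%:Z ^+ 2 *: D1 + p%:Z *: (('X - l%:P) * D2) + ('X - l%:P) ^+ 2 * D3.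
Proof.
pose r1 : 'rV[{poly int}]_k :=
  \row_j - (numq (2%:R * (B 0 (rshift 1 j) - l%:~R * A0 g.+1 0 (rshift 1 j)) / p%:R))%:P.
pose r2 : 'rV[{poly int}]_k :=
  \row_j (2 * (rshift 1 j == rev_ord 0 :> 'I_(1 + k)))%:R.
have p0 : p%:R != 0 :> rat by rewrite pnatr_eq0; case: (p) pP.
have [BT B00] := BW0.
have rE : ursubmx M = p%:Z%:P *: r1 + ('X - l%:P) *: r2.
  apply/matrixP => i j; rewrite ord1 !mxE; set e := rshift 1 j.
  rewrite (_ : lshift k 0 = 0); last by apply/val_inj.
  have -> : numq (2%:R * B 0 e) =
      p%:Z * numq (2%:R * (B 0 e - l%:~R * A0 g.+1 0 e) / p%:R) +
      l * (2 * (e == rev_ord 0))%:R.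
    apply: (@intr_inj rat); rewrite rmorphD !rmorphM /= !numqK ?row_int //.
    rewrite rmorph_nat natrM -pmulrn [p%:R * _]mulrC divfK // mxE; ring.
  by rewrite [A0 _ _ _]mxE polyCD !polyCM !polyC_natr -mulr_natr; ring.
have MT : dlsubmx M = (ursubmx M)^T.
  apply/matrixP => i j; rewrite !mxE -[in RHS]BT mxE; congr ('X *+ (2 * nat_of_bool _) - _).
  by rewrite -(inj_eq rev_ord_inj) rev_ordK eq_sym.
have M00 : ulsubmx M = 0.
  apply/matrixP => i j; rewrite !ord1 !mxE (_ : lshift k 0 = 0); last by apply/val_inj.
  have -> : B 0 0 = 0.
    have /matrixP/(_ 0 0) := B00; rewrite !mxE => <-.
    by congr (B _ _); apply/val_inj.
  by rewrite mulr0 /= subr0 -val_eqE /= /k addnS.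
have := det_border_bilinear r1 r2 r1^T r2^T (drsubmx M) p%:Z%:P ('X - l%:P).
have -> : p%:Z%:P *: r1^T + ('X - l%:P) *: r2^T = dlsubmx M.
  by rewrite MT rE linearD !linearZ.
rewrite /= -rE -M00 submxK => detM.
exists ((-1) ^+ g.+1 * \det (block_mx (ulsubmx M) r1 r1^T (drsubmx M))).
exists ((-1) ^+ g.+1 * (\det (block_mx (ulsubmx M) r1 r2^T (drsubmx M)) +
                        \det (block_mx (ulsubmx M) r2 r1^T (drsubmx M)))).
exists ((-1) ^+ g.+1 * \det (block_mx (ulsubmx M) r2 r2^T (drsubmx M))).
rewrite /F detM -!mul_polyC polyC_exp; move: ((-1) ^+ g.+1 : {poly int}) => s.
by ring.
Qed.

Lemma sqr_dvd_resultant_fB :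
  exists e z, (2 ^ e)%:R * resultant (fB B) (fB B)^`() = ((p ^ 2)%:Z * z)%:~R.
Proof.
have [D1 [D2 [D3 FE]]] := F_expansion.
have F_gt1 : (1 < size F)%N by rewrite size_F.
have /dvdzP[z resF] := sqr_dvd_resultant_deriv pP F_gt1 lead_F FE.
pose N := ((size (fB B)^`()).-1 + (size (fB B)).-1)%N.
exists (k.+1 * N)%N, z; rewrite [_ * z]mulrC -resF.
rewrite map_resultant_int -deriv_map map_F derivZ resultantZ ?expf_neq0 //.
by rewrite -exprM natrX.
Qed.

Lemma padic_val_DeltaB_of_row : padic_val_ge p 2 (DeltaB B).
Proof.
have [e [z E]] := sqr_dvd_resultant_fB.
have cop : coprime p (2 ^ e).
  apply: coprimeXr; rewrite coprime_sym prime_coprime // dvdn2.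
  by rewrite pO.
rewrite /DeltaB /discr; set s := 'C(_, _).
apply: (@padic_val_ge_sqr p (2 ^ e) _ ((-1) ^+ s * z)) => //; first by rewrite expn_gt0.
rewrite mulrCA E !rmorphM rmorphXn rmorphN1 /=; exact: mulrCA.
Qed.

End StrongDivisibility.

(** * Choice of the center *)

Lemma squarefree_exp_dvd (m e k : nat) :
    (0 < m)%N -> squarefree m ->
    (forall p, prime p -> (p %| m)%N -> (p ^ e %| k)%N) ->
  (m ^ e %| k)%N.
Proof.
move=> m_gt0 sqf dvd; apply/dvdn_partP => [|p]; first by rewrite expn_gt0 m_gt0.
rewrite mem_primes => /and3P[pP _]; rewrite Euclid_dvdX // => /andP[pm _].
rewrite p_part lognX (_ : logn p m = 1%N) ?muln1 ?dvd //.
apply/eqP; rewrite eqn_leq logn_gt0 mem_primes pP m_gt0 pm /= andbT leqNgt.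
by rewrite -pfactor_dvdn //; apply/negP => p2; have p1 := sqf p p2; rewrite p1 in pP.
Qed.

(** Used to find one integer reducing to the double root of f modulo every prime factor of m. *)
Lemma chinese_periodic (P : nat -> int -> Prop) (s : seq nat) :
    uniq s -> all prime s ->
    (forall p, p \in s -> exists r, P p r) ->
    (forall p a b, p \in s -> (p%:Z %| a - b)%Z -> P p a -> P p b) ->
  exists l, forall p, p \in s -> P p l.
Proof.
elim: s => [|q s IHs] /=; first by move=> _ _ _ _; exists 0.
move=> /andP[qs us] /andP[qP sP] exP perP.
have [||l Pl] := IHs us sP.
- by move=> p ps; apply: exP; rewrite inE ps orbT.
- by move=> p a b ps; apply: perP; rewrite inE ps orbT.
have [r Pr] := exP q (mem_head q s).
have cop : coprimez q%:Z (\prod_(p <- s) p)%N%:Z.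
  rewrite coprimezE /= prime_coprime // Euclid_dvd_prod //.
  rewrite big_has; apply/hasPn => p ps /=; rewrite dvdn_prime2 ?(allP sP p ps) //.
  by apply: contraNneq qs => ->.
pose z : int := zchinese q%:Z (\prod_(p <- s) p)%N%:Z r l.
exists z => p.
rewrite inE => /predU1P[->|ps].
  apply: (perP q r _ (mem_head q s) _ Pr).
  by rewrite -eqz_mod_dvd eq_sym zchinese_modl.
apply: (perP p l _ _ _ (Pl p ps)); first by rewrite inE ps orbT.
apply: (@dvdz_trans (\prod_(p <- s) p)%N%:Z).
  by rewrite dvdzE /= (big_rem p) //= dvdn_mulr.
by rewrite -eqz_mod_dvd eq_sym zchinese_modr.
Qed.

Lemma exists_center (g m : nat) (f : {poly int}) :
    (0 < g)%N -> (0 < m)%N -> squarefree m -> in_Wm2 g m f ->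
  exists l : int, (m%:Z %| f^`().[l])%Z && ((m ^ 2)%:Z %| 2 * f.[l])%Z.
Proof.
move=> g_gt0 m_gt0 sqf [fM sf weak].
have f_gt1 : (1 < size f)%N by rewrite sf; lia.
have mP p : p \in primes m -> prime p /\ (p %| m)%N.
  by rewrite mem_primes => /and3P[].
pose P p (l : int) := (2 <= mult_mod f (Fp_to_Fpbar p l%:~R))%N.
have [||||l Pl] := @chinese_periodic P (primes m).
- exact: primes_uniq.
- by apply/allP => p /mP[].
- move=> p /mP[pP pm]; have [_ [r [mr _]]] := weak p pP pm.
  exists (r : nat)%:Z; rewrite /P.
  by rewrite -pmulrn natr_Zp mr.
- move=> p a b /mP[pP _]; rewrite (dvdz_Fp _ pP) intrB subr_eq0 => /eqP ab.
  by rewrite /P ab.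
have {}Pl p : prime p -> (p %| m)%N -> P p l.
  by move=> pP pm; apply: Pl; rewrite mem_primes pP m_gt0.
exists l; rewrite !dvdzE !absz_nat -{1}[m]expn1; apply/andP; split.
  apply: squarefree_exp_dvd => // p pP pm.
  by have := multiple_root_dvd pP fM (Pl p pP pm) => /andP[_]; rewrite dvdzE expn1.
apply: squarefree_exp_dvd => // p pP pm.
have /andP[pf _] := multiple_root_dvd pP fM (Pl p pP pm).
rewrite abszM; have [p2|pO] := even_prime pP.
  (* At p = 2 only 2 | f(l) is available; the extra factor 2 completes the square. *)
  by move: pf; rewrite p2 dvdzE => pf; rewrite -mulnn dvdn_mul.
have := weakly_divides_sqr_dvd pP fM (Pl p pP pm) pO f_gt1 (weak p pP pm).
by rewrite dvdzE absz_nat => /dvdn_mull ->.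
Qed.

(** * Assembling the map *)

Lemma strongly_divides_section_mx (g m p : nat) (l : int) (a : nat -> int) :
    (0 < g)%N -> prime p -> odd p -> (p %| m)%N ->
    in_half_W0Z (section_mx g m l a) ->
  strongly_divides p (section_mx g m l a).
Proof.
case: g => // g _ pP pO /dvdnP[k mE] [[sT s0] s_int] C [[CT C0] C_int].
have p0 : p%:R != 0 :> rat by rewrite pnatr_eq0; case: (p) pP.
(* The row criterion is applied to the perturbed matrix with the same [l]: adding p C keeps the
   first row congruent to that of l A_0. *)
apply: (@padic_val_DeltaB_of_row g p _ l pP pO).
- split; first by rewrite linearD linearZ /= sT CT.
  apply/matrixP => i j; move/matrixP/(_ i j): s0; move/matrixP/(_ i j): C0.
  by rewrite !mxE => -> ->; rewrite mulr0 addr0.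
- move=> i j; rewrite !mxE mulrDr rpredD //; last first.
    by rewrite mulrCA rpredM ?natr_int.
  by have := s_int i j; rewrite !mxE.
move=> j; set S := section_mx _ _ _ _.
(* The first row of S - l A_0 has m as its only nonzero entry; [b] tells whether column j is the one
   holding it. *)
have [b Sb] : exists b : bool, S 0 j - l%:~R * A0 g.+1 0 j = m%:R *+ b.
  rewrite /S /section_mx mxE [X in _ + X - _]mxE addrK mxE.
  case: splitP => // i /= i0; rewrite mxE.
  case: split => j'; first by exists false; rewrite mxE.
  by rewrite mxE -i0 /super_entry; eexists.
have -> : 2%:R * ((S + p%:R *: C) 0 j - l%:~R * A0 g.+1 0 j) / p%:R =
    2%:R * k%:R *+ b + 2%:R * C 0 j.
  rewrite [(S + _) 0 j]mxE [(_ *: C) 0 j]mxE addrAC Sb mE natrM -mulr_natr.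
  by apply: (mulIf p0); rewrite divfK // -[in RHS]mulr_natr; ring.
by rewrite rpredD // rpredMn ?rpredM ?natr_int.
Qed.

(** The coefficients of f(X + l) are the Taylor coefficients a_k of f at l; in particular a_0 = f(l)
    and a_1 = f'(l), which turns the hypotheses into those for half-integrality. *)
Lemma section_mx_spec (g m : nat) (f : {poly int}) (l : int) :
    (0 < g)%N -> (0 < m)%N -> f \is monic -> size f = (2 * g + 1).+1 ->
    (m%:Z %| f^`().[l])%Z && ((m ^ 2)%:Z %| 2 * f.[l])%Z ->
  let B := section_mx g m l (fun k => (f \Po ('X + l%:P))`_k) in
  [/\ in_half_W0Z B, fB B = map_poly (intr : int -> rat) f & `|Q B| = m%:R].
Proof.
move=> g_gt0 m_gt0 fM sf /andP[f'l fl]; set h := f \Po _ => B.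
have h0 : h`_0 = f.[l] by rewrite -horner_coef0 horner_comp !hornerE.
have h1 : h`_1 = f^`().[l].
  have := coef_deriv h 0; rewrite mulr1n => <-.
  by rewrite -horner_coef0 deriv_comp derivD derivX derivC addr0 mulr1 horner_comp !hornerE.
have sh : size h = (g + g).+2 by rewrite size_comp_poly2 ?size_XaddC // sf; lia.
split; last exact: Q_section_mx.
  by apply: section_mx_half_integral; rewrite ?h0 ?h1.
rewrite fB_section_mx // -[f in RHS](comp_polyXaddC_K f l) -/h.
rewrite map_comp_poly map_polyXsubC /= comp_polyE.
rewrite size_map_inj_poly //; last exact: intr_inj.
rewrite sh [RHS]big_ord_recr /= [LHS]addrC coef_map.
(* The top Taylor coefficient is 1 as f is monic; it matches the separate leading term of
   [fB_section_mx]. *)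
have -> : h`_(g + g).+1 = 1.
  have := lead_coef_comp f (q := 'X + l%:P); rewrite -/h lead_coefE sh => -> //.
    by rewrite (monicP fM) lead_coefXaddC expr1n mulr1.
  by rewrite size_XaddC.
congr (_ + _); last by rewrite scale1r.
by apply: eq_bigr => k _; rewrite coef_map mul_polyC.
Qed.

Theorem theorem3p3 (g m : nat) (hg : (1 <= g)%N) (hm : (0 < m)%N)
    (hsq : squarefree m) :
  exists sigma : {f : {poly int} | in_Wm2 g m f} ->
                 {B : 'M[rat]_(g + g.+1) | in_half_W0Z B},
    forall f : {f : {poly int} | in_Wm2 g m f},
      [/\ fB (proj1_sig (sigma f)) = map_poly (intr : int -> rat) (proj1_sig f),
          (forall p : nat, prime p -> odd p -> (p %| m)%N ->
             strongly_divides p (proj1_sig (sigma f))) &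
          `|Q (proj1_sig (sigma f))| = m%:R].
Proof.
(* The condition on the center is a boolean on integers, so [xchoose] makes it a function of f. *)
pose l (f : {f | in_Wm2 g m f}) := xchoose (exists_center hg hm hsq (proj2_sig f)).
have spec (f : {f | in_Wm2 g m f}) :=
  let: And3 fM sf _ := proj2_sig f in
  section_mx_spec hg hm fM sf (xchooseP (exists_center hg hm hsq (proj2_sig f))).
exists (fun f => exist _ _ (let: And3 B_int _ _ := spec f in B_int)) => f /=.
have [B_int fBE QE] := spec f.
by split=> // p pP pO pm; apply: strongly_divides_section_mx.
Qed.
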